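(* Let $n\ge 1$, let $\mathrm d$ be a distance on $[n]$, let $\Pi^*$ be a permutation of $[n]$, and let $\hat{\mathrm d}$ be a symmetric real-valued function on $[n]\times[n]$. Assume that there are $\varepsilon>0$, $\delta>0$ and $\alpha\ge 1$ such that: (i) $|\hat{\mathrm d}(i,j)-\mathrm d(i,j)|\le \varepsilon$ for all $i,j\in[n]$; (ii) $\mathrm d(\Pi^*(i),\Pi^*(i+1))\le\delta$ for all $i\in[n-1]$; (iii) $\mathrm d(\Pi^*(i),\Pi^*(k))\ge \frac1\alpha\,\mathrm d(\Pi^*(i),\Pi^*(j))$ for all $i\le j\le k$ in $[n]$, and also for all $k\le j\le i$ in $[n]$. Then the procedure PINES (defined in the context) run on $\hat{\mathrm d}$ with parameters $$\rho_3=\delta+\varepsilon,\qquad \rho_2=\alpha\delta+2(1+\alpha)\varepsilon,\qquad \rho_1=\alpha^2\delta+(2\alpha^2+3\alpha+2)\varepsilon$$ terminates (every step can be carried out) and yields a permutation $\hat\Pi$ of $[n]$ such that, for either $\Pi=\hat\Pi^{-1}$ or $\Pi=\hat\Pi^{-1}\tau$, one has for all $i\in[n]$ $$\mathrm d(\Pi(i),\Pi^*(i))\le(2\alpha+1)\rho_1+2\alpha\varepsilon .$$ In particular, there is a universal numerical constant $C>0$ such that, for either $\Pi=\hat\Pi^{-1}$ or $\Pi=\hat\Pi^{-1}\tau$, for all $p\in[1,\infty]$, $$\Big(\sum_{i=1}^n \mathrm d(\Pi(i),\Pi^*(i))^p\Big)^{1/p}\le C\,n^{1/p}\alpha^3(\delta+\varepsilon)$$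 (with the usual maximum interpretation when $p=\infty$).
   Context: $[n]=\{1,\dots,n\}$, and $\tau$ is the permutation of $[n]$ reversing the order, $\tau(i)=n+1-i$. PINES with input $\hat{\mathrm d}$ and radii $\rho_1,\rho_2,\rho_3>0$: 1. Choose a maximal $\rho_1$-packing $\mathcal P\subset[n]$ for $\hat{\mathrm d}$, i.e. a subset, maximal for inclusion, with $\hat{\mathrm d}(i,j)>\rho_1$ for all distinct $i,j\in\mathcal P$, together with a partition $[n]=\bigsqcup_{i\in\mathcal P}P_i$ such that $i\in P_i$ and $\hat{\mathrm d}(i,j)\le\rho_1$ for all $j\in P_i\setminus\{i\}$. 2. For each $i\in\mathcal P$, let $G_i$ be the graph with vertex set $\{j\in[n]:\hat{\mathrm d}(i,j)>\rho_2\}$ in which two distinct vertices $j,k$ are joined by an edge iff $\hat{\mathrm d}(j,k)\le\rho_3$. It is required that $\mathcal P\setminus\{i\}$ is contained in the union of at most two connected components of $G_i$; the traces of these components on $\mathcal P\setminus\{i\}$ are denoted $\mathcal C_i^-$ and $\mathcal C_i^+$, with $\mathcal C_i^+=\emptyset$ if $\mathcal P\setminus\{i\}$ lies in a single component (or is empty). 3. Choose $i_1\in\mathcal P$ with $\mathcal C_{i_1}^+=\emptyset$. Then for $k=2,\dots,|\mathcal P|$ recursively choose $i_k\in\mathcal P$ such that $\mathcal C^-_{i_k}$ or $\mathcal C^+_{i_k}$ equals $\{i_1,\dots,i_{k-1}\}$. 4. Output a permutation $\hat\Pi$ of $[n]$ ($\hat\Pi(j)$ is the rank of object $j$) that ranks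 all elements of $P_{i_1}$ first, then all elements of $P_{i_2}$, and so on, the order inside each $P_{i_k}$ being arbitrary. The procedure fails if some required choice is impossible. The result holds for every way of making the arbitrary choices. *)

(* Defs.v *)
From mathcomp Require Import all_boot all_order all_algebra all_fingroup.
From mathcomp Require Import reals exp.

Set Implicit Arguments.
Unset Strict Implicit.
Unset Printing Implicit Defensive.

Import Order.TTheory GRing.Theory Num.Theory.
Local Open Scope ring_scope.

(* [n] is encoded as 'I_n: objects, ranks and positions are numbered from 0. *)

Record is_distance (R : realType) (n : nat) (d : 'I_n -> 'I_n -> R) : Prop :=
  IsDistance {
    distance_ge0 : forall i j, 0 <= d i j;
    distance_eq0 : forall i j, d i j = 0 <-> i = j;
    distance_sym : forall i j, d i j = d j i;
    distance_triangle : forall i j k, d i k <= d i j + d j k }.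

Definition tau (n : nat) : {perm 'I_n} := perm (@rev_ord_inj n).

Section Pines.
Variables (R : realType) (n : nat) (dh : 'I_n -> 'I_n -> R).
Variables (rho1 rho2 rho3 : R).

Implicit Types (P U : {set 'I_n}) (B Cm Cp : 'I_n -> {set 'I_n}).

Definition packing P : bool :=
  [forall i in P, forall j in P, (i != j) ==> (rho1 < dh i j)].

Definition packing_partition P B : Prop :=
  [/\ \bigcup_(i in P) B i = [set: 'I_n],
      {in P &, forall i j, i != j -> [disjoint B i & B j]},
      {in P, forall i, i \in B i} &
      {in P, forall i j, j \in B i -> j != i -> dh i j <= rho1}].

Definition graph_vertices (i : 'I_n) : {set 'I_n} := [set j | rho2 < dh i j].

Definition graph_edge (i : 'I_n) : rel 'I_n := fun j k =>
  [&& j \in graph_vertices i, k \in graph_vertices i, j != k & dh j k <= rho3].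

Definition graph_components (i : 'I_n) : {set {set 'I_n}} :=
  equivalence_partition (connect (graph_edge i)) (graph_vertices i).

Definition at_most_one_component (i : 'I_n) U : Prop :=
  U = set0 \/ exists2 A, A \in graph_components i & U \subset A.

(* [traces i U V W] : U is contained in the union of at most two components
   of G_i, and V, W are admissible values of C_i^-, C_i^+ for U = P \ {i}.
   When two components are needed, which of them is labelled - is arbitrary. *)
Variant traces (i : 'I_n) U : {set 'I_n} -> {set 'I_n} -> Prop :=
| TracesOne of at_most_one_component i U : traces i U U set0
| TracesTwo A1 A2 of
    A1 \in graph_components i & A2 \in graph_components i &
    U \subset A1 :|: A2 & ~ at_most_one_component i U :
    traces i U (A1 :&: U) (A2 :&: U).

(* The permutation [r] maps an object to its rank. *)
Definition ranks_by_blocks B (s : seq 'I_n) (r : {perm 'I_n}) : Prop :=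
  {in s &, forall i j, (index i s < index j s)%N ->
    forall x y, x \in B i -> y \in B j -> (r x < r y)%N}.

(* The procedure is a nondeterministic transition system, one transition per
   choice. [Ordering P B Cm Cp s] is reached once s = [:: i_1; ...; i_k] has
   been chosen. The values of B, Cm, Cp outside P are irrelevant. *)
Inductive pines_state : Type :=
| Start
| Packed of {set 'I_n} & ('I_n -> {set 'I_n})
| Split of {set 'I_n} & ('I_n -> {set 'I_n}) &
    ('I_n -> {set 'I_n}) & ('I_n -> {set 'I_n})
| Ordering of {set 'I_n} & ('I_n -> {set 'I_n}) &
    ('I_n -> {set 'I_n}) & ('I_n -> {set 'I_n}) & seq 'I_n
| Output of {perm 'I_n}.

Variant pines_step : pines_state -> pines_state -> Prop :=
| StepPack P B of maxset packing P & packing_partition P B :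
    pines_step Start (Packed P B)
| StepSplit P B Cm Cp of
    {in P, forall i, traces i (P :\ i) (Cm i) (Cp i)} :
    pines_step (Packed P B) (Split P B Cm Cp)
| StepFirst P B Cm Cp i of i \in P & Cp i = set0 :
    pines_step (Split P B Cm Cp) (Ordering P B Cm Cp [:: i])
| StepNext P B Cm Cp s i of
    (size s < #|P|)%N & i \in P &
    Cm i = [set x in s] \/ Cp i = [set x in s] :
    pines_step (Ordering P B Cm Cp s) (Ordering P B Cm Cp (rcons s i))
| StepOutput P B Cm Cp s r of size s = #|P| & ranks_by_blocks B s r :
    pines_step (Ordering P B Cm Cp s) (Output r).

Inductive pines_reachable : pines_state -> Prop :=
| ReachStart : pines_reachable Start
| ReachStep S T of pines_reachable S & pines_step S T : pines_reachable T.

Definition is_output (S : pines_state) : Prop := exists r, S = Output r.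

(* Every way of making the choices from S on leads, after finitely many
   transitions, to an output: no infinite run, and no failure. *)
Inductive terminates_from (S : pines_state) : Prop :=
| TerminatesFrom of
    is_output S \/ (exists T, pines_step S T) &
    (forall T, pines_step S T -> terminates_from T).

Definition pines_terminates : Prop := terminates_from Start.

Definition pines_yields (r : {perm 'I_n}) : Prop := pines_reachable (Output r).

End Pines.

(* Since (s * t)%g x = t (s x), the permutation i |-> r^-1 (tau i) is
   (tau * r^-1)%g. *)
Definition up_to_reversal (n : nat) (r : {perm 'I_n})
    (Q : {perm 'I_n} -> Prop) : Prop :=
  Q r^-1%g \/ Q (tau n * r^-1)%g.

(* Main.v *)
(* Identify objects with their hidden position q. By monotonicity, two objects
   of the packing on the same side of i are joined in G_i through all the
   objects between them, whereas an edge of G_i cannot jump over i. Hence C_i^-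
   and C_i^+ are the two sides of i in the packing, and every run enumerates the
   packing by increasing or by decreasing position. For the accuracy, suppose
   that x receives the rank of an object y located after x. By the pigeonhole
   principle some z located at y or after it is ranked before x, so the center c
   of the block of z does not come after the center a of the block of x.
   Whatever the position of c with respect to x, monotonicity bounds d(x, y) by
   alpha (d(x, a) + d(c, z)) or 2 alpha d(c, z), and d(x, a) and d(c, z) are at
   most rho_1 + eps. *)

Require Import Defs.
From mathcomp Require Import all_boot all_order all_algebra all_fingroup.
From mathcomp Require Import reals exp.
From mathcomp Require Import zify ring lra.

Set Implicit Arguments.
Unset Strict Implicit.
Unset Printing Implicit Defensive.

Import Order.TTheory GRing.Theory Num.Theory.
Local Open Scope ring_scope.

(** * Sides of an object and initial segments of a set for a given order *)

Section Positions.
Variable n : nat.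
Implicit Types (q : {perm 'I_n}) (P : {set 'I_n}) (s : seq 'I_n).

Definition below q P i : {set 'I_n} := [set j in P | (q j < q i)%N].
Definition above q P i : {set 'I_n} := [set j in P | (q i < q j)%N].

(** [q] sends objects to positions. Nonemptiness fixes the direction of the enumeration: an empty
    [s] would also be the upper side of the last object of [P]. *)
Definition initial_run q P s : Prop :=
  [/\ s != [::], {subset s <= P}, sorted (fun x y => q x < q y)%N s &
      {in P, forall x, x \notin s -> {in s, forall y, (q y < q x)%N}}].

Lemma ltn_tau q (i j : 'I_n) :
  ((q * tau n)%g i < (q * tau n)%g j)%N = (q j < q i)%N.
Proof. by rewrite !permM !permE /=; move: (ltn_ord (q i)) (ltn_ord (q j)); lia. Qed.

Lemma leq_tau q (i j : 'I_n) :
  ((q * tau n)%g i <= (q * tau n)%g j)%N = (q j <= q i)%N.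
Proof. by rewrite leqNgt ltn_tau -leqNgt. Qed.

Lemma tauV : (tau n)^-1%g = tau n.
Proof.
apply/permP => i; apply: (@perm_inj _ (tau n)).
by rewrite permKV !permE rev_ordK.
Qed.

Lemma below_tau q P i : below (q * tau n)%g P i = above q P i.
Proof. by apply/setP => j; rewrite !inE ltn_tau. Qed.

Lemma ltn_perm_neq q (i j : 'I_n) : j != i -> (q i < q j)%N = ~~ (q j < q i)%N.
Proof.
move=> ji; rewrite -leqNgt [RHS]leq_eqVlt orbC; case: ltnP => //= _.
by apply/esym/negbTE; rewrite (inj_eq val_inj) (inj_eq perm_inj) eq_sym.
Qed.

Lemma in_below q P i j : j \in P :\ i -> (j \in below q P i) = (q j < q i)%N.
Proof. by case/setD1P => _ jP; rewrite inE jP. Qed.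

Lemma in_above q P i j : j \in P :\ i -> (j \in above q P i) = ~~ (q j < q i)%N.
Proof. by case/setD1P => ji jP; rewrite inE jP ltn_perm_neq. Qed.

Lemma setD1_sides q P i : P :\ i = below q P i :|: above q P i.
Proof.
apply/setP => j; rewrite !inE; case: eqVneq => [->|ji].
  by rewrite !ltnn !andbF.
by rewrite (ltn_perm_neq q ji) -andb_orr orbN andbT.
Qed.

Lemma initial_run_uniq q P s : initial_run q P s -> uniq s.
Proof.
case=> _ _ srt _; apply: sorted_uniq srt => [y x z|x]; last by rewrite ltnn.
exact: ltn_trans.
Qed.

Lemma initial_run_full q P s : initial_run q P s -> size s = #|P| -> s =i P.
Proof.
move=> run sz; have u := initial_run_uniq run; case: run => _ sP _ _.
apply: subset_cardP; last exact/subsetP.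
by rewrite (card_uniqP u).
Qed.

Lemma initial_run1 q P i : i \in P -> below q P i = set0 ->
  initial_run q P [:: i].
Proof.
move=> iP b0; split=> //.
  by move=> x; rewrite inE => /eqP->.
move=> x xP; rewrite inE => xi y; rewrite inE => /eqP->.
rewrite ltn_perm_neq //; apply/negP => lt.
by have := in_set0 x; rewrite -b0 inE xP lt.
Qed.

Lemma initial_run_rcons q P s i : initial_run q P s -> i \in P ->
  below q P i = [set x in s] -> initial_run q P (rcons s i).
Proof.
case=> s0 sP srt dn iP bi.
have lt_i x : x \in s -> (q x < q i)%N.
  by move=> xs; move/setP/(_ x): bi; rewrite !inE xs => /andP[].
split.
- by case: (s).
- by move=> x; rewrite mem_rcons inE => /orP[/eqP->|/sP].
- case: s s0 sP srt dn bi lt_i => //= x s _ _ srt _ _ lt_i.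
  by rewrite rcons_path srt lt_i // mem_last.
- move=> x xP; rewrite mem_rcons inE negb_or => /andP[xi xs] y.
  rewrite mem_rcons inE => /orP[/eqP->|]; last exact: dn.
  rewrite ltn_perm_neq //; apply: contra xs => lt.
  by move/setP/(_ x): bi; rewrite !inE xP lt => /esym.
Qed.

(** If they were equal, [i] would lie outside [s], hence after the head of [s], which would itself
    lie above [i]. This forbids a run of the procedure from changing direction. *)
Lemma initial_run_above q P s i : initial_run q P s -> i \in P ->
  above q P i <> [set x in s].
Proof.
case=> s0 _ _ dn iP ai.
have nis : i \notin s by move/setP/(_ i): ai; rewrite !inE ltnn andbF => /esym/negbT.
case: s s0 dn ai nis => // x s _ dn ai nis.
have xs : x \in x :: s by rewrite mem_head.
move/setP/(_ x): ai; rewrite !inE eqxx => /andP[_ lt].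
by have := dn i iP nis x xs; rewrite ltnNge ltnW.
Qed.

(** The witness is the object of least position in [P] outside [s]; it keeps an incomplete run from
    getting stuck. *)
Lemma initial_run_next q P s : initial_run q P s -> (size s < #|P|)%N ->
  exists2 i, i \in P & below q P i = [set x in s].
Proof.
move=> run sz; have u := initial_run_uniq run; case: run => _ sP _ dn.
have [i0] : exists i, (i \in P) && (i \notin s).
  apply/existsP; apply: contraLR sz; rewrite negb_exists => /forallP H.
  rewrite -leqNgt -(card_uniqP u); apply/subset_leq_card/subsetP => x xP.
  by have := H x; rewrite xP negbK.
case/(arg_minnP (P := fun i => (i \in P) && (i \notin s)) (fun i => q i)) => i.
case/andP=> iP is_ imin.
exists i => //; apply/setP => x; rewrite !inE; apply/andP/idP.
  by case=> xP; apply: contraLR => xs; rewrite -leqNgt imin // xP xs.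
by move=> xs; split; [exact: sP | exact: dn].
Qed.

Lemma below_eq0_exists q P : P != set0 -> exists2 i, i \in P & below q P i = set0.
Proof.
case/set0Pn => i0 /(arg_minnP (P := mem P) (fun i => q i)) [i iP imin].
exists i => //; apply/setP => x; rewrite !inE.
by apply/negP => /andP[/imin]; rewrite leqNgt => /negbTE->.
Qed.

(* Otherwise [[set z | r z < r x]] is included in [[set z | q z < q y]]; these
   sets have the same cardinal, but only the second one contains [x]. *)
Lemma overtaken q (r : {perm 'I_n}) x y :
  r x = q y -> (q x < q y)%N -> exists2 z, (q y <= q z)%N & (r z < r x)%N.
Proof.
move=> rq lt.
pose A (t : {perm 'I_n}) := t @^-1: [set m : 'I_n | m < q y]%N.
have cardA t : #|A t| = #|[set m : 'I_n | m < q y]%N|.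
  exact/card_preimset/perm_inj.
have : ~~ (A r \subset A q).
  apply/negP => sub; have /eqP/setP/(_ x) : A r == A q.
    by rewrite eqEcard sub !cardA /=.
  by rewrite !inE rq ltnn lt.
case/subsetPn => z; rewrite !inE -leqNgt -rq; by exists z; rewrite -?rq.
Qed.

End Positions.

(** The rank is the index in the list of all objects sorted by [key]; ties are broken by the
    sort. *)
Lemma perm_by_key n (key : 'I_n -> nat) :
  exists r : {perm 'I_n}, forall x y, (key x < key y)%N -> (r x < r y)%N.
Proof.
pose e := sort (fun x y => key x <= key y)%N (enum 'I_n).
have e_all x : x \in e by rewrite mem_sort mem_enum.
have sz : size e = n by rewrite size_sort size_enum_ord.
have idx_lt x : (index x e < n)%N by rewrite -[X in (_ < X)%N]sz index_mem.
have inj : injective (fun x => Ordinal (idx_lt x)).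
  by move=> x y [/(congr1 (nth x e))]; rewrite !nth_index.
exists (perm inj) => x y; rewrite !permE /=; apply: contraTltn.
rewrite -leqNgt leq_eqVlt => /orP[/eqP|].
  by move/(congr1 (nth x e)); rewrite !nth_index // => ->.
apply: (sorted_ltn_index (leT := fun x y => key x <= key y)%N) => //.
  by move=> a b c; exact: leq_trans.
by apply: sort_sorted => a b; exact: leq_total.
Qed.

(** * Maximal packings, their partitions and rankings by blocks *)

Section Blocks.
Variables (R : realType) (n : nat) (dh : 'I_n -> 'I_n -> R) (rho1 : R).
Hypothesis dh_sym : forall i j, dh i j = dh j i.
Implicit Types (P : {set 'I_n}) (B : 'I_n -> {set 'I_n}) (i j : 'I_n).

Lemma packingP P :
  reflect {in P &, forall i j, i != j -> rho1 < dh i j} (packing dh rho1 P).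
Proof.
apply: (iffP forall_inP) => [H i j iP jP ij|H i iP].
  by move/forall_inP: (H i iP) => /(_ j jP); rewrite ij.
by apply/forall_inP => j jP; apply/implyP; apply: H.
Qed.

Lemma maxpacking_exists : exists P, maxset (packing dh rho1) P.
Proof.
have [|P Pmax] := @ex_maxset _ (packing dh rho1); last by exists P.
by exists set0; apply/packingP => i; rewrite inE.
Qed.

(** Otherwise [j |: P] would be a larger packing. *)
Lemma maxpacking_cover P j : maxset (packing dh rho1) P -> j \notin P ->
  exists2 i, i \in P & dh i j <= rho1.
Proof.
case/maxsetP => packP Pmax jP; apply/exists_inP; apply: contraR jP.
rewrite negb_exists_in => /forall_inP far.
rewrite -(Pmax (j |: P) _ (subsetUr _ _)) ?setU11 //.
apply/packingP => a b; rewrite !inE.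
case/predU1P => [->|aP] /predU1P[->|bP]; rewrite ?eqxx // => ab.
- by rewrite dh_sym ltNge far.
- by rewrite ltNge far.
- by move/packingP: packP; apply.
Qed.

Lemma maxpacking_neq0 P : (0 < n)%N -> maxset (packing dh rho1) P -> P != set0.
Proof.
move=> n0 Pmax; apply/set0Pn; case: (boolP (Ordinal n0 \in P)) => [|nP].
  by exists (Ordinal n0).
by have [i iP _] := maxpacking_cover Pmax nP; exists i.
Qed.

Lemma packing_partition_exists P : maxset (packing dh rho1) P ->
  exists B, packing_partition dh rho1 P B.
Proof.
move=> Pmax.
(* [f j] is the center of the block of [j]; by [maxpacking_cover] the default of [odflt] is never
   reached. *)
pose f j := if j \in P then j else odflt j [pick i in P | dh i j <= rho1].
have fP j : f j \in P.
  rewrite /f; case: ifPn => // jP; case: pickP => [i /andP[]//|no].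
  by have [i iP le] := maxpacking_cover Pmax jP; move: (no i); rewrite iP le.
have f_id i : i \in P -> f i = i by rewrite /f => ->.
exists (fun i => [set j | f j == i]); split.
- apply/setP => j; rewrite inE; apply/bigcupP.
  by exists (f j); rewrite ?fP ?inE ?eqxx.
- move=> i j iP jP ij; rewrite -setI_eq0; apply/eqP/setP => x; rewrite !inE.
  by apply/negP => /andP[/eqP fi /eqP fj]; move: ij; rewrite -fi -fj eqxx.
- by move=> i iP; rewrite inE f_id.
- move=> i iP j; rewrite inE /f; case: ifPn => [_ /eqP->|jP]; rewrite ?eqxx //.
  case: pickP => [k /andP[kP le] /eqP <- _ //|no].
  by have [k kP le] := maxpacking_cover Pmax jP; move: (no k); rewrite kP le.
Qed.

Lemma block_center P B x : packing_partition dh rho1 P B ->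
  exists2 i, i \in P & x \in B i.
Proof.
case=> cov _ _ _; have : x \in \bigcup_(i in P) B i by rewrite cov inE.
by case/bigcupP => i; exists i.
Qed.

Lemma ranking_exists P B s : packing_partition dh rho1 P B -> s =i P ->
  exists r, ranks_by_blocks B s r.
Proof.
move=> part sP; have [_ disj _ _] := part.
(* The key of [x] is the index in [s] of the center of its block, unique because the blocks are
   disjoint. *)
have [r rK] := perm_by_key (fun x => find (fun i => x \in B i) s).
exists r => i j is_ js ij x y xi yj; apply: rK.
have findE z k : k \in s -> z \in B k -> find (fun i => z \in B i) s = index k s.
  move=> ks zk; apply: eq_in_find => l ls /=; apply/idP/eqP => [zl|-> //].
  apply: contraTeq zl => lk; rewrite (disjointFr _ zk) //.
  by apply: disj; rewrite -?sP // eq_sym.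
by rewrite (findE x i) // (findE y j).
Qed.

End Blocks.

(** * Metric estimates and paths in the graphs $G_i$ *)

Section Seriation.
Variables (R : realType) (n : nat) (d dh : 'I_n -> 'I_n -> R).
Variables (eps delta alpha : R).
Hypotheses (dist : is_distance d) (dh_sym : forall i j, dh i j = dh j i).
Hypotheses (eps_gt0 : 0 < eps) (delta_gt0 : 0 < delta) (alpha_ge1 : 1 <= alpha).
Hypothesis close : forall i j, `|dh i j - d i j| <= eps.
Implicit Types (q r : {perm 'I_n}) (P : {set 'I_n}) (i j k x y z : 'I_n).

Let rho3 := delta + eps.
Let rho2 := alpha * delta + 2 * (1 + alpha) * eps.
Let rho1 := alpha ^+ 2 * delta + (2 * alpha ^+ 2 + 3 * alpha + 2) * eps.

Local Notation packing := (packing dh rho1).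
Local Notation vertices := (graph_vertices dh rho2).
Local Notation edge := (graph_edge dh rho2 rho3).

(** [q] plays the role of the inverse of $\Pi^*$, from objects to positions; the monotonicity
    assumption is multiplied by [alpha] to clear the division. *)
Definition seriated q : Prop :=
  (forall i j, q j = (q i).+1 :> nat -> d i j <= delta) /\
  (forall i j k, (q i <= q j <= q k)%N || (q k <= q j <= q i)%N ->
     d i j <= alpha * d i k).

(** Both conditions are invariant under reversal, the first by symmetry of [d]. One-sided arguments
    thus need only one side. *)
Lemma seriated_tau q : seriated q -> seriated (q * tau n)%g.
Proof.
case=> step mono; split=> [i j ji|i j k]; last first.
  by rewrite !leq_tau => H; apply: mono; rewrite orbC andbC (andbC (q i <= _)%N).
rewrite (distance_sym dist); apply: step; move: ji; rewrite !permM !permE /=.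
by move: (ltn_ord (q i)) (ltn_ord (q j)); lia.
Qed.

Lemma dh_le i j : dh i j <= d i j + eps.
Proof. by have := close i j; rewrite ler_norml; lra. Qed.

Lemma d_le i j : d i j <= dh i j + eps.
Proof. by have := close i j; rewrite ler_norml; lra. Qed.

Lemma alpha_ge0 : 0 <= alpha.
Proof. exact: le_trans alpha_ge1. Qed.

Lemma rho1_ge0 : 0 <= rho1.
Proof.
have aad : 0 <= alpha ^+ 2 * delta by rewrite mulr_ge0 ?exprn_ge0 ?alpha_ge0 ?ltW.
have aae : 0 <= alpha ^+ 2 * eps by rewrite mulr_ge0 ?exprn_ge0 ?alpha_ge0 ?ltW.
have ae : 0 <= alpha * eps by rewrite mulr_ge0 ?alpha_ge0 ?ltW.
by have := eps_gt0; rewrite /rho1; lra.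
Qed.

(** The two sides differ by exactly [eps]. *)
Lemma rho1_gt : alpha * (rho2 + eps) + eps < rho1.
Proof. by have := eps_gt0; rewrite /rho1 /rho2; lra. Qed.

Lemma edge_sym i : symmetric (edge i).
Proof. by move=> j k; rewrite /graph_edge dh_sym eq_sym andbCA. Qed.

Lemma edge_connect_sym i : connect_sym (edge i).
Proof. exact/sym_connect_sym/edge_sym. Qed.

Section OneOrder.
Variable q : {perm 'I_n}.
Hypothesis ser : seriated q.

(** If [dh i k <= rho2], then monotonicity gives [d i j <= alpha * (rho2 + eps)], so [dh i j < rho1]
    by [rho1_gt]. *)
Lemma between_vertex i j k : (q i <= q j <= q k)%N || (q k <= q j <= q i)%N ->
  rho1 < dh i j -> k \in vertices i.
Proof.
case: ser => _ mono /mono le; rewrite inE !ltNge; apply: contra => le2.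
apply/ltW/le_lt_trans/rho1_gt; apply: le_trans (dh_le _ _) _; rewrite lerD2r.
apply: le_trans le _; rewrite ler_wpM2l ?alpha_ge0 //.
by apply: le_trans (d_le _ _) _; rewrite lerD2r.
Qed.

(** Walk from [j] to [k] one position at a time: every object met is a vertex by [between_vertex],
    and consecutive ones are at most [delta + eps = rho3] apart for [dh]. *)
Lemma connect_right i j k : (q i < q j)%N -> (q j <= q k)%N -> rho1 < dh i j ->
  connect (edge i) j k.
Proof.
move=> ij jk far; have [m km] : exists m, (q k = q j + m :> nat)%N.
  by exists (q k - q j)%N; rewrite subnKC.
elim: m => [|m IHm] in k jk km *.
  by rewrite (_ : k = j) //; apply/(@perm_inj _ q)/val_inj; rewrite /= km addn0.
have lt : (q j + m < n)%N by move: (ltn_ord (q k)); lia.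
pose l := (q^-1)%g (Ordinal lt).
have ql : q l = (q j + m)%N :> nat by rewrite permKV.
apply: (connect_trans (IHm l _ ql)); first by rewrite ql leq_addr.
apply: connect1; rewrite /graph_edge !(between_vertex _ far) /=; try lia.
apply/andP; split.
  by apply/eqP => lk; move: km; rewrite -lk ql; lia.
case: ser => step _; apply: le_trans (dh_le _ _) _; rewrite lerD2r step //.
by rewrite km ql addnS.
Qed.

(** An edge across [i] has [d j k <= rho3 + eps], so monotonicity bounds [dh j i] by
    [alpha * (delta + 2 * eps) + eps], which is less than [rho2]; but [j] is a vertex. *)
Lemma edge_same_side i j k : edge i j k -> (q j < q i)%N -> (q k < q i)%N.
Proof.
case/and4P => jV kV _ le ji; rewrite ltnNge; apply/negP => ik.
case: ser => _ mono.
have := mono j i k; rewrite ltnW // ik => /(_ isT).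
have := d_le j k; have := dh_le j i; move: jV le.
rewrite inE (dh_sym i) /rho2 /rho3 => jV le hd1 hd2 mono_j.
have : alpha * d j k <= alpha * (delta + 2 * eps).
  by rewrite ler_wpM2l ?alpha_ge0; lra.
by have := eps_gt0; lra.
Qed.

Lemma connect_same_side i j k : connect (edge i) j k ->
  (q j < q i)%N = (q k < q i)%N.
Proof.
apply: (@closed_connect _ (edge i) [pred l | q l < q i]%N) => a b /= ab.
apply/idP/idP; apply: edge_same_side; first exact: ab.
by rewrite edge_sym.
Qed.

End OneOrder.

Lemma connect_left q i j k : seriated q -> (q j < q i)%N -> (q k <= q j)%N ->
  rho1 < dh i j -> connect (edge i) j k.
Proof.
move=> /seriated_tau ser ji kj.
by apply: (connect_right ser); rewrite ?ltn_tau ?leq_tau.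
Qed.

(** * Traces of the components on the packing *)

Section OnePacking.
Variables (q : {perm 'I_n}) (P : {set 'I_n}).
Hypotheses (ser : seriated q) (packP : packing P).

Lemma packing_vertex i j : i \in P -> j \in P :\ i -> j \in vertices i.
Proof.
move=> iP /setD1P[ji jP].
have far : rho1 < dh i j by move/packingP: packP; apply; rewrite // eq_sym.
by apply: (between_vertex ser _ far); rewrite leqnn andbT /= leq_total.
Qed.

Lemma connect_packing i j k : i \in P -> j \in P :\ i -> k \in P :\ i ->
  connect (edge i) j k = ((q j < q i)%N == (q k < q i)%N).
Proof.
move=> iP jU kU; apply/idP/eqP; first exact: connect_same_side.
wlog jk : j k jU kU / (q j <= q k)%N.
  move=> H; case/orP: (leq_total (q j) (q k)) => [/H|/H H' /esym]; first exact.
  by rewrite edge_connect_sym; exact: H'.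
have far l : l \in P :\ i -> rho1 < dh i l.
  by case/setD1P => li lP; move/packingP: packP; apply; rewrite // eq_sym.
(* The walk starts from the object nearer to [i] in position: [k] on the left side, [j] on the
   right. *)
case: (ltnP (q j) (q i)) => ji /esym.
  move=> ki; rewrite edge_connect_sym.
  exact: (connect_left ser) (far _ _).
move=> _; apply: (connect_right ser) => //; last exact: far.
by rewrite ltn_perm_neq -?leqNgt //; case/setD1P: jU.
Qed.

(** [A] is a connectivity class, and by [connect_packing] connectivity within [P :\ i] means lying
    on the same side of [i]. *)
Lemma component_trace i j (A : {set 'I_n}) : i \in P -> j \in A :&: (P :\ i) ->
  A \in graph_components dh rho2 rho3 i ->
  A :&: (P :\ i) = if (q j < q i)%N then below q P i else above q P i.
Proof.
move=> iP /setIP[jA jU] /imsetP[x xV Ax].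
have -> : A :&: (P :\ i) = [set k in P :\ i | (q j < q i)%N == (q k < q i)%N].
  apply/setP => k; rewrite in_setI [RHS]in_set andbC.
  case: (boolP (k \in P :\ i)) => //= kU; rewrite -connect_packing //.
  move: jA; rewrite Ax !in_set => /andP[_ xj].
  have := packing_vertex iP kU; rewrite inE => ->.
  by rewrite (same_connect (edge_connect_sym i) xj).
apply/setP => k; case: ifP => _; rewrite !inE; case: eqVneq => [->|ki] //=.
- by rewrite ltnn andbF.
- by rewrite ltnn andbF.
- by rewrite (ltn_perm_neq q ki) eq_sym eqbF_neg.
Qed.

Definition component_of i j : {set 'I_n} :=
  [set k in vertices i | connect (edge i) j k].

Lemma component_of_in i j : i \in P -> j \in P :\ i ->
  component_of i j \in graph_components dh rho2 rho3 i.
Proof. by move=> iP jU; apply/imset_f/packing_vertex. Qed.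

Lemma component_of_trace i j : i \in P -> j \in P :\ i ->
  component_of i j :&: (P :\ i) = if (q j < q i)%N then below q P i else above q P i.
Proof.
move=> iP jU; apply: component_trace (component_of_in iP jU) => //.
by rewrite in_setI jU in_set connect0 packing_vertex.
Qed.

Lemma one_sided i : i \in P -> below q P i = set0 \/ above q P i = set0 ->
  at_most_one_component dh rho2 rho3 i (P :\ i).
Proof.
move=> iP one; have [->|[j jU]] := set_0Vmem (P :\ i); first by left.
right; exists (component_of i j); first exact: component_of_in.
apply/setIidPr; rewrite component_of_trace //.
have := in_below q jU; have := in_above q jU; rewrite (setD1_sides q).
by case: one => ->; case: ltnP; rewrite in_set0 ?set0U ?setU0.
Qed.

(** The last clause serves the first choice of a run: if nothing lies below [i], then [W] is empty
    under either labelling. *)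
Lemma traces_sides i V W : i \in P -> traces dh rho2 rho3 i (P :\ i) V W ->
  (V = below q P i /\ W = above q P i \/ V = above q P i /\ W = below q P i) /\
  (V = set0 -> W = set0).
Proof.
move=> iP [].
- move=> one; split=> //.
  have [U0|[j jU]] := set_0Vmem (P :\ i).
    left; move: (U0); rewrite (setD1_sides q) => /eqP; rewrite setU_eq0.
    by case/andP=> /eqP-> /eqP->; rewrite setU0.
  case: one => [U0|[A Acomp UA]]; first by rewrite U0 inE in jU.
  have := component_trace (j := j) iP _ Acomp.
  rewrite (setIidPr UA) => /(_ jU); move: (setD1_sides q).
  (* [P :\ i] equals one side and contains the other, which is therefore empty by disjointness. *)
  have I0 : below q P i :&: above q P i = set0.
    apply/setP => k; rewrite !inE; apply/negP => /andP[/andP[_ ki] /andP[_]].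
    by rewrite ltnNge ltnW.
  by case: ifP => _ s e; [left|right]; split=> //; rewrite -I0;
    [apply/setIidPr | apply/setIidPl]; rewrite -e s ?subsetUr ?subsetUl.
- move=> A1 A2 comp1 comp2 UA two.
  have [b0|[j jb]] := set_0Vmem (below q P i).
    by case: two; apply: one_sided; [|left].
  have [a0|[k ka]] := set_0Vmem (above q P i).
    by case: two; apply: one_sided; [|right].
  have jU : j \in P :\ i by rewrite (setD1_sides q) inE jb.
  have kU : k \in P :\ i by rewrite (setD1_sides q) inE ka orbT.
  have qj : (q j < q i)%N by move: jb; rewrite inE => /andP[].
  have qk : (q k < q i)%N = false by move: ka; rewrite inE => /andP[_ /ltnW/leq_gtF].
  have tr l A (comp : A \in graph_components dh rho2 rho3 i) lA :=
    @component_trace i l A iP lA comp.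
  (* Hence [j] and [k] are split between [A1] and [A2], which determines both traces. *)
  have notboth A : A \in graph_components dh rho2 rho3 i -> j \in A -> k \in A -> False.
    move=> comp jA kA; have := tr j A comp; rewrite !in_setI jA jU qj => /(_ isT) e.
    have : k \in A :&: (P :\ i) by rewrite inE kA.
    by rewrite e inE qk andbF.
  have: j \in A1 :|: A2 by apply: (subsetP UA).
  have: k \in A1 :|: A2 by apply: (subsetP UA).
  rewrite !in_setU => /orP[kA|kA] /orP[jA|jA]; try by [case: (notboth _ _ jA kA)].
    have e1 : A1 :&: (P :\ i) = above q P i by rewrite (tr k) ?in_setI ?kA ?kU ?qk.
    have e2 : A2 :&: (P :\ i) = below q P i by rewrite (tr j) ?in_setI ?jA ?jU ?qj.
    rewrite e1 e2; split; first by right.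
    by move=> a0; rewrite a0 inE in ka.
  have e1 : A1 :&: (P :\ i) = below q P i by rewrite (tr j) ?in_setI ?jA ?jU ?qj.
  have e2 : A2 :&: (P :\ i) = above q P i by rewrite (tr k) ?in_setI ?kA ?kU ?qk.
  rewrite e1 e2; split; first by left.
  by move=> a0; rewrite a0 inE in jb.
Qed.

(** Emptiness of a side is decidable, so the traces are given by an explicit function, with values
    in pairs. *)
Lemma traces_exist : exists C, {in P, forall i,
  traces dh rho2 rho3 i (P :\ i) (C i).1 (C i).2}.
Proof.
exists (fun i => if (below q P i == set0) || (above q P i == set0)
  then (P :\ i, set0) else (below q P i, above q P i)) => i iP.
case: ifPn => [/orP H|].
  by apply: TracesOne; apply: one_sided => //; case: H => /eqP; [left|right].
rewrite negb_or => /andP[/set0Pn[j jb] /set0Pn[k ka]] /=.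
have jU : j \in P :\ i by rewrite (setD1_sides q) inE jb.
have kU : k \in P :\ i by rewrite (setD1_sides q) inE ka orbT.
have qj : (q j < q i)%N by move: jb; rewrite inE => /andP[].
have qk : (q k < q i)%N = false by move: ka; rewrite inE => /andP[_ /ltnW/leq_gtF].
have ej := component_of_trace iP jU; have ek := component_of_trace iP kU.
rewrite qj in ej; rewrite qk in ek; rewrite -ej -ek.
apply: TracesTwo; rewrite ?component_of_in //.
  by apply/setIidPr; rewrite setIUl ej ek -setD1_sides.
case=> [U0|[A comp UA]]; first by rewrite U0 inE in jU.
have := component_trace (j := j) iP _ comp; rewrite (setIidPr UA) qj.
by move=> /(_ jU) e; move: kU; rewrite e inE qk andbF.
Qed.

End OnePacking.

(** * Accuracy of a ranking by blocks *)

Definition block_monotone q r rho : Prop := forall x z, (r z < r x)%N ->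
  exists a c, [/\ (q c <= q a)%N, d x a <= rho & d c z <= rho].

(** Reversal exchanges [x] with [z] and the block centers [a] with [c]. *)
Lemma block_monotone_tau q r rho :
  block_monotone q r rho -> block_monotone (q * tau n)%g (r * tau n)%g rho.
Proof.
move=> H x z; rewrite ltn_tau => /H[a [c [ca za cx]]].
by exists c, a; rewrite leq_tau; split; rewrite // (distance_sym dist).
Qed.

Lemma displacement_lt q r rho x y : seriated q -> block_monotone q r rho ->
  r x = q y -> (q x < q y)%N -> d x y <= 2 * alpha * rho.
Proof.
move=> [_ mono] blocks rxy xy.
have [z yz /blocks[a [c [ca xa cz]]]] := overtaken rxy xy.
have alpha_le i j k u : (q i <= q j <= q k)%N || (q k <= q j <= q i)%N ->
    d i k <= u -> d i j <= alpha * u.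
  by move=> /mono le iku; apply: le_trans le _; rewrite ler_wpM2l ?alpha_ge0.
have tri := distance_triangle dist x c y.
have -> : 2 * alpha * rho = alpha * rho + alpha * rho by ring.
have rho0 : 0 <= alpha * rho.
  by rewrite mulr_ge0 ?alpha_ge0 // (le_trans _ xa) ?(distance_ge0 dist).
(* Order [c], [x], [y], [z]: both [d c x] and [d c y] are controlled by [d c z]. *)
case: (leqP (q c) (q x)) => cx.
  apply: le_trans tri _; rewrite lerD // 1?(distance_sym dist x);
  by apply: alpha_le cz; lia.
(* Now [y] lies between [x] and [a], so [d x a] alone suffices. *)
case: (leqP (q y) (q a)) => ya.
  by rewrite (le_trans (alpha_le _ _ _ _ _ xa)) ?lerDl //; lia.
(* Order [x], [c], [a], [y], [z]: [d x c] is controlled by [d x a], and [d c y] by [d c z]. *)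
apply: le_trans tri _; rewrite lerD //.
  by apply: alpha_le xa; lia.
by apply: alpha_le cz; lia.
Qed.

Lemma displacement q r rho i : seriated q -> block_monotone q r rho -> 0 <= rho ->
  d (r^-1%g i) (q^-1%g i) <= 2 * alpha * rho.
Proof.
move=> ser blocks rho0; set x := r^-1%g i; set y := q^-1%g i.
have rxy : r x = q y by rewrite !permKV.
case: (ltngtP (q x) (q y)) => [| |/val_inj/perm_inj->].
- exact: displacement_lt blocks _.
- rewrite -ltn_tau.
  apply: displacement_lt (seriated_tau ser) (block_monotone_tau blocks) _.
  by rewrite !permM rxy.
- have [_ ->//] := distance_eq0 dist y y.
  by rewrite !mulr_ge0 ?alpha_ge0.
Qed.

(** Were the center of [x] before that of [z], it would come first in the sorted list [s], and its
    whole block would be ranked first. *)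
Lemma ranks_by_blocks_monotone q P B s r : packing_partition dh rho1 P B ->
  initial_run q P s -> s =i P -> ranks_by_blocks B s r ->
  block_monotone q r (rho1 + eps).
Proof.
move=> part run sP rank x z zx.
have near a w : a \in P -> w \in B a -> d a w <= rho1 + eps.
  move=> aP wa; case: (eqVneq w a) => [->|wa'].
    have [_ ->//] := distance_eq0 dist a a.
    by rewrite addr_ge0 ?rho1_ge0 ?ltW.
  by apply: le_trans (d_le _ _) _; rewrite lerD2r; case: part => _ _ _; apply.
have [a aP xa] := block_center x part; have [c cP zc] := block_center z part.
exists a, c; split; [|by rewrite (distance_sym dist) near|exact: near].
rewrite leqNgt; apply: contraTN zx => ac; rewrite -leqNgt ltnW //.
apply: (rank a c); rewrite ?sP // ltnNge leq_eqVlt negb_or.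
have ca : index c s != index a s.
  apply/eqP => /(congr1 (nth a s)); rewrite !nth_index ?sP // => ca.
  by rewrite ca ltnn in ac.
rewrite ca; apply: contraTN ac => idx; rewrite -leqNgt ltnW //.
case: run => _ _ srt _; apply: (sorted_ltn_index _ srt) => //; rewrite ?sP //.
by move=> u v w; exact: ltn_trans.
Qed.

(** * Invariant, progress and termination of the procedure *)

Section Run.
Variable q : {perm 'I_n}.
Hypotheses (n_gt0 : (0 < n)%N) (ser : seriated q).

Local Notation step := (pines_step dh rho1 rho2 rho3).
Local Notation traces := (traces dh rho2 rho3).

(* Two mirror images of the hidden order fit the data equally well; a run of
   the procedure enumerates the packing along one of them. *)
Definition oriented (Q : {perm 'I_n} -> Prop) : Prop := Q q \/ Q (q * tau n)%g.

Lemma orientedE Q : oriented Q -> exists2 q', seriated q' & Q q'.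
Proof. by case; [exists q | exists (q * tau n)%g => //; exact: seriated_tau]. Qed.

Lemma oriented_mono (Q Q' : {perm 'I_n} -> Prop) :
  (forall q', seriated q' -> Q q' -> Q' q') -> oriented Q -> oriented Q'.
Proof.
by move=> QQ' [/QQ'|/QQ'] H; [left|right]; apply: H => //; exact: seriated_tau.
Qed.

Definition invariant (S : pines_state n) : Prop :=
  match S with
  | Start => True
  | Packed P B => maxset packing P /\ packing_partition dh rho1 P B
  | Defs.Split P B Cm Cp =>
      [/\ maxset packing P, packing_partition dh rho1 P B &
          {in P, forall i, traces i (P :\ i) (Cm i) (Cp i)}]
  | Ordering P B Cm Cp s =>
      [/\ maxset packing P, packing_partition dh rho1 P B,
          {in P, forall i, traces i (P :\ i) (Cm i) (Cp i)} &
          oriented (fun q' => initial_run q' P s)]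
  | Output r => oriented (fun q' =>
      forall i, d (r^-1%g i) (q'^-1%g i) <= 2 * alpha * (rho1 + eps))
  end.

Lemma invariant_step S T : invariant S -> step S T -> invariant T.
Proof.
move=> + ST; case: ST => /=.
- by [].
- by move=> P B Cm Cp tr [].
- move=> P B Cm Cp i iP Cp0 [Pmax part tr]; split=> //.
  have packP := maxsetp Pmax.
  (* The empty side [Cp i] fixes the orientation: [i] is the last object of [P] in the first case,
     the first one in the second. *)
  case: (traces_sides ser packP iP (tr i iP)).1 => [[_ e]|[_ e]].
    by right; apply: initial_run1 => //; rewrite below_tau -e.
  by left; apply: initial_run1 => //; rewrite -e.
- move=> P B Cm Cp s i _ iP Ci [Pmax part tr orient]; split=> //.
  apply: oriented_mono orient => q' ser' run.
  apply: initial_run_rcons => //.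
  have nab := initial_run_above run iP.
  by case: (traces_sides ser' (maxsetp Pmax) iP (tr i iP)).1 => [[e1 e2]|[e1 e2]];
    case: Ci; rewrite ?e1 ?e2.
- move=> P B Cm Cp s r sz rank [Pmax part tr orient].
  apply: oriented_mono orient => q' ser' run i.
  apply: (@displacement q' r) => //; last by rewrite addr_ge0 ?rho1_ge0 ?ltW.
  exact: ranks_by_blocks_monotone (initial_run_full run sz) rank.
Qed.

Lemma invariant_progress S : invariant S -> is_output S \/ exists T, step S T.
Proof.
case: S => /= [_|P B [Pmax part]|P B Cm Cp [Pmax part tr]|
  P B Cm Cp s [Pmax part tr orient]|r _].
- have [P Pmax] := maxpacking_exists dh rho1.
  have [B part] := packing_partition_exists dh_sym Pmax.
  by right; exists (Packed P B); constructor.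
- have [C tr] := traces_exist ser (maxsetp Pmax).
  by right; exists (Defs.Split P B (fun i => (C i).1) (fun i => (C i).2)); constructor.
- have [i iP b0] := below_eq0_exists q (maxpacking_neq0 dh_sym n_gt0 Pmax).
  right; exists (Ordering P B Cm Cp [:: i]); constructor => //.
  have [[[e1 e2]|[_ ->//]] C0] := traces_sides ser (maxsetp Pmax) iP (tr i iP).
  by apply: C0; rewrite e1.
- right; have [q' ser' run] := orientedE orient.
  have : (size s <= #|P|)%N.
    rewrite -(card_uniqP (initial_run_uniq run)); apply/subset_leq_card/subsetP.
    by case: run.
  rewrite leq_eqVlt => /orP[/eqP sz|lt].
    have [r rank] := ranking_exists part (initial_run_full run sz).
    by exists (Output r); econstructor; eauto.
  have [i iP bi] := initial_run_next run lt.
  exists (Ordering P B Cm Cp (rcons s i)); constructor => //.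
  by case: (traces_sides ser' (maxsetp Pmax) iP (tr i iP)).1 => [[-> _]|[_ ->]];
    [left|right].
- by left; exists r.
Qed.

(** A measure decreased by every transition. With [n.+1] it stays positive even after [n] choices,
    so the output transition decreases it too. *)
Definition remaining (S : pines_state n) : nat :=
  match S with
  | Start => n + 4
  | Packed _ _ => n + 3
  | Defs.Split _ _ _ _ => n + 2
  | Ordering _ _ _ _ s => n.+1 - size s
  | Output _ => 0
  end.

Lemma remaining_step S T : step S T -> (remaining T < remaining S)%N.
Proof.
have le P : (#|P| <= n)%N by rewrite -[X in (_ <= X)%N]card_ord max_card.
case=> /= [||P B Cm Cp i _ _|P B Cm Cp s i lt _ _|P B Cm Cp s r -> _]; try lia.
  by rewrite size_rcons; have := leq_trans lt (le P); lia.
by rewrite subn_gt0 ltnS.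
Qed.

Lemma pines_terminates_seriated : pines_terminates dh rho1 rho2 rho3.
Proof.
suff H m S : (remaining S < m)%N -> invariant S -> terminates_from dh rho1 rho2 rho3 S.
  exact: H (ltnSn _) _.
elim: m S => [|m IHm] S lt inv; first by rewrite ltn0 in lt.
constructor; first exact: (invariant_progress inv).
move=> T ST; apply: (IHm _ _ (invariant_step inv ST)).
by rewrite -ltnS; apply: leq_ltn_trans (remaining_step ST) lt.
Qed.

Lemma pines_yields_seriated r : pines_yields dh rho1 rho2 rho3 r ->
  oriented (fun q' => forall i, d (r^-1%g i) (q'^-1%g i) <= 2 * alpha * (rho1 + eps)).
Proof.
(* Induction on reachability requires the goal as the invariant of an arbitrary state. *)
rewrite -/(invariant (Output r)) /pines_yields; move: (Output r) => S.
by elim=> // S' T _; exact: invariant_step.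
Qed.

End Run.

(** * The numerical constant and the $p$-norms *)

Lemma displacement_bound_le :
  2 * alpha * (rho1 + eps) <= 16 * alpha ^+ 3 * (delta + eps).
Proof.
have e0 := eps_gt0; have d0 := delta_gt0.
(* The coefficient of [eps] on the left is $2\alpha^2+3\alpha+3\le 8\alpha^2$; doubling this 8 gives
   the constant 16. *)
have le : rho1 + eps <= 8 * alpha ^+ 2 * (delta + eps).
  have ae : alpha * eps <= alpha ^+ 2 * eps.
    by rewrite ler_wpM2r ?(ltW e0) // ler_eXnr.
  have ee : eps <= alpha ^+ 2 * eps by rewrite ler_peMl ?(ltW e0) // exprn_ege1.
  have ad : 0 <= alpha ^+ 2 * delta.
    by rewrite mulr_ge0 ?exprn_ge0 ?alpha_ge0 ?(ltW d0).
  by rewrite /rho1; lra.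
have -> : 16 * alpha ^+ 3 * (delta + eps)
  = 2 * alpha * (8 * alpha ^+ 2 * (delta + eps)) by ring.
by rewrite ler_wpM2l // mulr_ge0 ?alpha_ge0.
Qed.

End Seriation.

Lemma pnorm_le (R : realType) (n : nat) (F : 'I_n -> R) (M p : R) :
  1 <= p -> (forall i, 0 <= F i <= M) -> 0 <= M ->
  (\sum_(i < n) F i `^ p) `^ p^-1 <= n%:R `^ p^-1 * M.
Proof.
move=> p1 FM M0; have p0 : 0 < p by exact: lt_le_trans p1.
have -> : n%:R `^ p^-1 * M = (n%:R * M `^ p) `^ p^-1.
  by rewrite powRM ?powR_ge0 // -powRrM mulfV ?gt_eqF // powRr1.
have le : \sum_(i < n) F i `^ p <= n%:R * M `^ p.
  rewrite mulr_natl -[X in _ *+ X]card_ord -sumr_const ler_sum // => i _.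
  by case/andP: (FM i) => F0 FiM; rewrite ge0_ler_powR ?nnegrE ?(ltW p0).
rewrite ge0_ler_powR ?nnegrE ?invr_ge0 ?(ltW p0) ?mulr_ge0 ?powR_ge0 //.
by rewrite sumr_ge0 // => i _; exact: powR_ge0.
Qed.

Theorem theorem2 (R : realType) :
  exists C : R, 0 < C /\
  forall (n : nat) (d : 'I_n -> 'I_n -> R) (Pistar : {perm 'I_n})
    (dh : 'I_n -> 'I_n -> R) (eps delta alpha : R),
  (0 < n)%N ->
  is_distance d ->
  (forall i j, dh i j = dh j i) ->
  0 < eps -> 0 < delta -> 1 <= alpha ->
  (forall i j, `|dh i j - d i j| <= eps) ->
  (forall i j : 'I_n, j = i.+1 :> nat -> d (Pistar i) (Pistar j) <= delta) ->
  (forall i j k : 'I_n, (i <= j <= k)%N || (k <= j <= i)%N ->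
     alpha^-1 * d (Pistar i) (Pistar j) <= d (Pistar i) (Pistar k)) ->
  let rho3 := delta + eps in
  let rho2 := alpha * delta + 2 * (1 + alpha) * eps in
  let rho1 := alpha ^+ 2 * delta
              + (2 * alpha ^+ 2 + 3 * alpha + 2) * eps in
  pines_terminates dh rho1 rho2 rho3 /\
  forall Pihat : {perm 'I_n}, pines_yields dh rho1 rho2 rho3 Pihat ->
    up_to_reversal Pihat (fun Pi => forall i : 'I_n,
      d (Pi i) (Pistar i) <= (2 * alpha + 1) * rho1 + 2 * alpha * eps) /\
    up_to_reversal Pihat (fun Pi =>
      (forall p : R, 1 <= p ->
        (\sum_(i < n) d (Pi i) (Pistar i) `^ p) `^ p^-1
          <= C * n%:R `^ p^-1 * alpha ^+ 3 * (delta + eps)) /\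
      \big[Num.max/0]_(i < n) d (Pi i) (Pistar i)
        <= C * alpha ^+ 3 * (delta + eps)).
Proof.
exists 16; split; first by rewrite ltr0n.
move=> n d Pistar dh eps delta alpha n0 dist dh_sym eps0 delta0 alpha1 close.
move=> step mono rho3 rho2 rho1.
have alpha0 : 0 < alpha by apply: lt_le_trans alpha1.
have ser : seriated d delta alpha Pistar^-1%g.
  split=> [i j /step|i j k /mono]; rewrite !permKV //.
  by rewrite ler_pdivrMl.
have rho1_pos : 0 <= rho1 by exact: rho1_ge0.
split=> [|Pihat]; first exact: pines_terminates_seriated ser.
move/(pines_yields_seriated dist dh_sym eps0 delta0 alpha1 close ser) => orient.
set M := 2 * alpha * (rho1 + eps).
have bound : up_to_reversal Pihat (fun Pi =>
    forall i, d (Pi i) (Pistar i) <= M).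
  case: orient => H; [left|right] => i.
    by have := H i; rewrite invgK.
  (* Evaluating at [tau n i] moves the reversal from [Pistar] to the inverse of [Pihat]. *)
  by have := H (tau n i); rewrite invMg tauV invgK !permM -{2}tauV permK.
have lift (Q : {perm 'I_n} -> Prop) :
    (forall Pi : {perm 'I_n}, (forall i, d (Pi i) (Pistar i) <= M) -> Q Pi) ->
    up_to_reversal Pihat Q.
  by move=> MQ; case: bound => /MQ; [left|right].
have M_le : M <= 16 * alpha ^+ 3 * (delta + eps) by exact: displacement_bound_le.
have D_ge0 := distance_ge0 dist.
have M'0 : 0 <= 16 * alpha ^+ 3 * (delta + eps).
  by rewrite !mulr_ge0 ?addr_ge0 ?exprn_ge0 ?ltW.
split; apply: lift => Pi le.
  (* [M] is smaller than the required bound by [rho1], which is nonnegative. *)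
  by move=> i; apply: le_trans (le i) _; rewrite /M; lra.
split=> [p p1|].
  have -> : 16 * n%:R `^ p^-1 * alpha ^+ 3 * (delta + eps)
    = n%:R `^ p^-1 * (16 * alpha ^+ 3 * (delta + eps)) by ring.
  by apply: pnorm_le => // i; rewrite D_ge0 (le_trans (le i)).
by apply: bigmax_le => // i _; exact: le_trans (le i) _.
Qed.
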